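(* For every integer $n\ge 1$, $\overline{p}_3(7n)\equiv (-1)^n r_3(n)\pmod 7$.
   Context: $\overline{p}_3(n)$ denotes the number of overpartition triples of $n$ (triples of overpartitions whose parts together sum to $n$, where an overpartition is a partition in which the first occurrence of each distinct part may be overlined), with $\overline{p}_3(0)=1$; equivalently $\sum_{n\ge0}\overline{p}_3(n)q^n=\big((-q;q)_\infty/(q;q)_\infty\big)^3$, where $(a;q)_\infty=\prod_{n\ge0}(1-aq^n)$. For $k,n\ge0$, $r_k(n)$ denotes the number of representations of $n$ as a sum of $k$ squares, i.e. the number of $(x_1,\dots,x_k)\in\mathbb{Z}^k$ with $x_1^2+\cdots+x_k^2=n$. *)

(* Defs.v *)
From mathcomp Require Import all_boot all_order all_algebra zify.

Set Implicit Arguments.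
Unset Strict Implicit.
Unset Printing Implicit Defensive.

Import Order.TTheory GRing.Theory Num.Theory.

Local Open Scope nat_scope.

(* An overpartition is listed as the sequence of its parts in nonincreasing
   order; the boolean attached to a part tells whether it is overlined. *)
Definition is_overpartition (s : seq (nat * bool)) : bool :=
  let parts := unzip1 s in
  let marks := unzip2 s in
  [&& sorted geq parts,
      all (fun p => 0 < p) parts
    & [forall i : 'I_(size s),
         nth false marks i ==> (index (nth 0 parts i) parts == i)]].

Definition op_weight (s : seq (nat * bool)) : nat := sumn (unzip1 s).

(* The parts of an overpartition of m <= n are at most n, and there are at most
   n of them, so all of them live in this finite type: see [overpartition_code]
   below. *)
Notation op_code n := {bseq n of 'I_n.+1 * bool}.

Definition op_decode (n : nat) (c : op_code n) : seq (nat * bool) :=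
  [seq (val x.1, x.2) | x <- bseqval c].

(* The number of k-tuples of overpartitions of total weight n. *)
Definition overpartition_tuples (k n : nat) : nat :=
  #|[set c : {ffun 'I_k -> op_code n} |
      [forall i, is_overpartition (op_decode (c i))]
      && (\sum_(i < k) op_weight (op_decode (c i)) == n)]|.

(* The integers j - n for j < 2 n + 1 are those in [-n, n]; a representation of
   n as a sum of squares involves no others: see [sum_squares_code] below. *)
Definition int_decode (n : nat) (j : 'I_n.*2.+1) : int := (j%:Z - n%:Z)%R.

(* The number of representations of n as an (ordered) sum of k squares. *)
Definition sum_squares (k n : nat) : nat :=
  #|[set c : {ffun 'I_k -> 'I_n.*2.+1} |
      (\sum_(i < k) int_decode (c i) ^+ 2 == n%:Z :> int)%R]|.

(* The decoding maps are injective, and reach every overpartition (resp. every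
   integer) that the counts above have to take into account. *)
Lemma op_decode_inj (n : nat) : injective (@op_decode n).
Proof.
move=> c d /inj_map H; apply/val_inj/H => -[i a] [j b] /= [ij ->].
by congr pair; apply: val_inj.
Qed.

Lemma overpartition_code (n : nat) (s : seq (nat * bool)) :
  is_overpartition s -> op_weight s <= n -> exists c : op_code n, op_decode c = s.
Proof.
case/and3P=> _ pos _ le_n.
have szs : size s <= n.
  apply: leq_trans le_n; rewrite /op_weight.
  by elim: s pos => //= x s IH /andP[x0 /IH]; lia.
have les : all (fun x => x.1 <= n) s.
  move: le_n; rewrite /op_weight; clear; elim: s => //= x s IH le_n.
  by rewrite IH ?andbT; lia.
pose t : seq ('I_n.+1 * bool) := [seq (inord x.1, x.2) | x <- s].
have szt : size t <= n by rewrite size_map.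
exists (Bseq szt); rewrite /op_decode /= /t -map_comp.
apply: map_id_in => -[p b] /(allP les) /= le_pn.
by rewrite inordK.
Qed.

Lemma int_decode_inj (n : nat) : injective (@int_decode n).
Proof. by move=> i j /addIr [] /val_inj. Qed.

Lemma sum_squares_code (k n : nat) (x : 'I_k -> int) :
  (\sum_(i < k) x i ^+ 2 = n%:Z)%R ->
  exists c : {ffun 'I_k -> 'I_n.*2.+1}, forall i, int_decode (c i) = x i.
Proof.
move=> sumx.
have bd i : (- n%:Z <= x i <= n%:Z)%R.
  have : (x i ^+ 2 <= n%:Z)%R.
    by rewrite -sumx (bigD1 i) //= lerDl sumr_ge0 // => j _; rewrite sqr_ge0.
  by rewrite expr2; nia.
exists [ffun i => inord `|(x i + n%:Z)%R|] => i.
rewrite ffunE /int_decode inordK; last by have := bd i; lia.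
by have := bd i; lia.
Qed.

(* Main.v *)
Require Import Defs.
From mathcomp Require Import all_boot all_order all_algebra zify ring.

(* Let phi = 1 + 2 sum_(s >= 1) (-1)^s q^(s^2). By Gauss, the generating function
   of overpartitions is 1 / phi, so that of overpartition triples is
   phi^4 / phi^7, which modulo 7 is phi(q)^4 / phi(q^7). The coefficients of
   phi^k are (-1)^n r_k(n), and r_4(7 n) = r_4(n) modulo 7 because an
   integral quaternion of norm divisible by 7 has, up to units, exactly one left
   divisor of norm 7, or eight if it is itself divisible by 7. Hence extracting
   the exponents divisible by 7 turns phi(q)^4 / phi(q^7) into
   phi(q)^4 / phi(q) = phi(q)^3. *)

Set Implicit Arguments.
Unset Strict Implicit.
Unset Printing Implicit Defensive.

Import Order.TTheory GRing.Theory Num.Theory.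

Local Open Scope ring_scope.

(** * Gauss's theta product modulo a power of the variable *)

Section FiniteGauss.
Variables (R : comPzRingType) (q : R).

Definition qminus m n : R := \prod_(m <= k < n) (1 - q ^+ k.+1).
Definition qplus n : R := \prod_(0 <= k < n) (1 + q ^+ k.+1).
Definition theta n : R := 1 + 2 * \sum_(0 <= s < n) (-1) ^+ s.+1 * q ^+ (s.+1 ^ 2).
Definition theta_rem n s : R :=
  (-1) ^+ s.+1 * q ^+ (s.+1 * n.+1) * qplus s * qminus s.+1 n.

(** With T_s = (-1)^s q^((s+1)(n+1)) [qplus s] [qminus s n], the summand is T_s - T_(s+1). In the
    induction for [theta_finite], m = n, and the leftover -T_n is, up to the factor 2, what the new
    square of [theta] contributes beyond the new remainder term. *)
Lemma theta_rem_telescope n m : (m <= n)%N ->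
  \sum_(0 <= s < m) (theta_rem n.+1 s - (1 + q ^+ n.+1) * theta_rem n s)
  = q ^+ n.+1 * qminus 0 n
    - (-1) ^+ m * q ^+ (m.+1 * n.+1) * qplus m * qminus m n.
Proof.
elim: m => [|m IH] lt_mn.
  by rewrite big_geq // /qplus big_geq // mul1n expr0 mul1r mulr1 subrr.
rewrite big_nat_recr //= IH; last exact: ltnW.
rewrite /theta_rem [qminus m n]big_ltn // -/(qminus m.+1 n).
have -> : qminus m.+1 n.+1 = qminus m.+1 n * (1 - q ^+ n.+1).
  by rewrite /qminus big_nat_recr.
have -> : qplus m.+1 = qplus m * (1 + q ^+ m.+1) by rewrite /qplus big_nat_recr.
have -> : q ^+ (m.+1 * n.+2) = q ^+ (m.+1 * n.+1) * q ^+ m.+1.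
  by rewrite -exprD; congr (_ ^+ _); lia.
have -> : q ^+ (m.+2 * n.+1) = q ^+ (m.+1 * n.+1) * q ^+ n.+1.
  by rewrite -exprD; congr (_ ^+ _); lia.
rewrite (exprS (-1) m).
ring.
Qed.

(* A finite form, in the style of Shanks, of Gauss's product formula for
   [1 + 2 \sum_(s >= 1) (-1)^s q^(s^2)]: every remainder term has a factor
   [q ^+ n.+1]. *)
Lemma theta_finite n :
  theta n * qplus n = qminus 0 n + 2 * \sum_(0 <= s < n) theta_rem n s.
Proof.
elim: n => [|n IH]; first by rewrite /theta /qplus /qminus !big_geq // mulr0 addr0 mulr1.
have -> : theta n.+1 = theta n + 2 * ((-1) ^+ n.+1 * q ^+ (n.+1 ^ 2)).
  by rewrite /theta big_nat_recr //= mulrDr addrA.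
have S1 : qplus n.+1 = qplus n * (1 + q ^+ n.+1) by rewrite /qplus big_nat_recr.
have -> : qminus 0 n.+1 = qminus 0 n * (1 - q ^+ n.+1).
  by rewrite /qminus big_nat_recr.
have := theta_rem_telescope (leqnn n).
rewrite sumrB -mulr_sumr => /eqP; rewrite subr_eq => /eqP E.
rewrite big_nat_recr //= E S1 mulrDl [theta n * _]mulrA IH /theta_rem.
have -> : qminus n n = 1 by rewrite /qminus big_geq.
have -> : qminus n.+1 n.+1 = 1 by rewrite /qminus big_geq.
have -> : q ^+ (n.+1 * n.+2) = q ^+ (n.+1 * n.+1) * q ^+ n.+1.
  by rewrite -exprD; congr (_ ^+ _); lia.
rewrite -mulnn (exprS (-1) n).
ring.
Qed.
End FiniteGauss.

(** * Congruence of polynomials modulo a power of the variable *)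

Definition eqmodX (R : nzRingType) N (p q : {poly R}) := forall i, (i < N)%N -> p`_i = q`_i.

Section EqmodX.
Variables (R : comNzRingType) (N : nat).
Implicit Types p q u v : {poly R}.
Local Notation "p == q" := (eqmodX N p q).

Lemma eqmodX_refl p : p == p. Proof. by []. Qed.
Lemma eqmodX_trans q p u : p == q -> q == u -> p == u.
Proof. by move=> E F i iN; rewrite E // F. Qed.
Lemma eqmodX_add p q u v : p == q -> u == v -> p + u == q + v.
Proof. by move=> E F i iN; rewrite !coefD E // F. Qed.
Lemma eqmodX_mul p q u v : p == q -> u == v -> p * u == q * v.
Proof.
move=> E F i iN; rewrite !coefM; apply: eq_bigr => j _.
by rewrite E ?F //; have := ltn_ord j; lia.
Qed.
Lemma eqmodX_exp p q k : p == q -> p ^+ k == q ^+ k.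
Proof. by move=> E; elim: k => // k IH; rewrite !exprS; apply: eqmodX_mul. Qed.
Lemma eqmodX_mulXn p k : (N <= k)%N -> 'X^k * p == 0.
Proof. by move=> Nk i iN; rewrite coefXnM coef0 (leq_trans iN Nk). Qed.

(** A constant term 1 makes [u] invertible modulo ['X^N]: the lowest nonzero coefficient of [p - q]
    would survive in [(p - q) * u]. *)
Lemma eqmodX_cancel u p q : u`_0 = 1 -> p * u == q * u -> p == q.
Proof.
move=> u0 E; have {}E i : (i < N)%N -> ((p - q) * u)`_i = 0.
  by move=> iN; rewrite mulrBl coefB E // subrr.
suff D i : (i < N)%N -> (p - q)`_i = 0.
  by move=> i iN; apply/eqP; rewrite -subr_eq0 -coefB D.
elim/ltn_ind: i => i IH iN; have := E i iN.
rewrite coefM big_ord_recr /= subnn u0 mulr1 big1 ?add0r // => j _.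
by rewrite IH ?mul0r // (ltn_trans _ iN).
Qed.
End EqmodX.

Lemma gauss_eqmodX (R : comNzRingType) n :
  eqmodX n.+1 (theta 'X n * qplus 'X n) (qminus 'X 0 n : {poly R}).
Proof.
rewrite theta_finite -[X in eqmodX _ _ X]addr0.
apply: eqmodX_add => // i iN; rewrite mulr_sumr coef_sum coef0 big1 // => s _.
rewrite /theta_rem.
have -> : 2 * ((-1) ^+ s.+1 * 'X^(s.+1 * n.+1) * qplus 'X s * qminus 'X s.+1 n)
  = 'X^(s.+1 * n.+1) * (2 * (-1) ^+ s.+1 * qplus 'X s * qminus 'X s.+1 n) :> {poly R}.
  by ring.
by rewrite (@eqmodX_mulXn _ n.+1) ?coef0 //; lia.
Qed.

(** The operator U_d on series; [size p] is a sufficient length because d i >= i when d > 0. *)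
Definition multisect (R : nzRingType) d (p : {poly R}) : {poly R} :=
  \poly_(i < size p) p`_(d * i).

Lemma coef_multisect (R : nzRingType) d (p : {poly R}) i : (0 < d)%N ->
  (multisect d p)`_i = p`_(d * i).
Proof.
move=> d0; rewrite coef_poly; case: ltnP => // le_i.
by rewrite nth_default // (leq_trans le_i) // leq_pmull.
Qed.

(** By linearity in [u]: a factor ['X^d] before the extraction becomes a factor ['X] after it. *)
Lemma multisect_mul (R : comNzRingType) d (p u : {poly R}) : (0 < d)%N ->
  multisect d (p * (u \Po 'X^d)) = multisect d p * u.
Proof.
move=> d0; elim/poly_ind: u => [|u c IH].
  by rewrite comp_poly0 !mulr0; apply/polyP => i; rewrite coef_multisect // !coef0.
apply/polyP => i; rewrite coef_multisect // comp_polyD comp_polyM comp_polyX comp_polyC.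
rewrite !mulrDr !mulrA !coefD !coefMC coef_multisect // coefMXn coefMX; congr (_ + _).
case: i => [|i]; first by rewrite muln0 d0.
by rewrite ltnNge mulnS leq_addr /= addnC addnK -IH coef_multisect.
Qed.

(** * The generating function of overpartitions *)

Local Open Scope nat_scope.

Definition op_follows (x y : nat * bool) := (y.1 < x.1) || ((y.1 == x.1) && ~~ y.2).

Lemma op_follows_trans : transitive op_follows.
Proof. by move=> [y b] [x a] [z c]; rewrite /op_follows /=; lia. Qed.

(** As [op_follows] is transitive, the condition on neighbours holds for all pairs: an overlined
    part is smaller than every earlier part, hence is a first occurrence. *)
Lemma is_overpartitionE s :
  is_overpartition s = sorted op_follows s && all (fun x => 0 < x.1) s.
Proof.
rewrite /is_overpartition andbCA [RHS]andbC all_map; congr (_ && _).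
apply/andP/idP => [[/(sortedP 0) geq_s /forallP mark_s] | sorted_s].
  apply/(sortedP (0, false)) => i lt_is; have lt_is' := ltnW lt_is.
  have := geq_s i; rewrite size_map => /(_ lt_is).
  rewrite !(nth_map (0, false)) // /op_follows /geq /= leq_eqVlt.
  case/orP=> [/eqP E | -> //]; rewrite E ltnn eqxx /=; apply/negP => marked.
  have /implyP := mark_s (Ordinal lt_is).
  rewrite /= !(nth_map (0, false)) // => /(_ marked) /eqP idx.
  have := index_nth 0 (i := i) (s := unzip1 s).
  by rewrite size_map !(nth_map (0, false)) // -E idx ltnn => /(_ lt_is').
have /(pairwiseP (0, false)) pw : pairwise op_follows s.
  by rewrite -sorted_pairwise //; apply: op_follows_trans.
split.
  apply/(sortedP 0) => i; rewrite size_map => lt_is.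
  rewrite !(nth_map (0, false)) ?(ltnW lt_is) //.
  have := pw i i.+1; rewrite !inE => /(_ (ltnW lt_is) lt_is (ltnSn i)).
  by rewrite /op_follows /geq /=; lia.
apply/forallP => i; apply/implyP; rewrite (nth_map (0, false)) // => marked.
have p_in : nth 0 (unzip1 s) i \in unzip1 s by rewrite mem_nth ?size_map.
set j := index _ _; have lt_js : j < size s by rewrite -(size_map fst) index_mem.
have : j <= i by rewrite index_nth ?size_map.
rewrite leq_eqVlt => /orP[// | lt_ji].
have := pw j i; rewrite !inE => /(_ lt_js (ltn_ord i) lt_ji).
have := nth_index 0 p_in; rewrite -/j !(nth_map (0, false)) // /op_follows => ->.
by rewrite ltnn marked andbF.
Qed.

Definition letter_code (x : nat * bool) : nat := x.1.*2 - ~~ x.2.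
Definition letter (c : nat) : nat * bool := (uphalf c, ~~ odd c).

(* Overpartitions are the words in the letters 1 < 1' < 2 < 2' < ... (a prime
   marks an overlined part) that are nonincreasing and repeat no primed letter;
   [letter c] is the [c]-th letter of this chain. *)
Fixpoint enum_op fuel c w : seq (seq (nat * bool)) :=
  if fuel is k.+1 then
    if c is c'.+1 then
      enum_op k c' w ++
      (if uphalf c <= w then
         map (cons (letter c)) (enum_op k (uphalf c).*2.-1 (w - uphalf c))
       else [::])
    else if w == 0 then [:: [::]] else [::]
  else [::].

Lemma letterK c : letter_code (letter c) = c.
Proof. by rewrite /letter_code /letter /=; lia. Qed.

Lemma letter_codeK x : 0 < x.1 -> letter (letter_code x) = x.
Proof.
case: x => p b /= p0; rewrite /letter /letter_code /=.
by congr pair; case: b; lia.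
Qed.

(** After a part p, overlined or not, the largest letter allowed is the plain p, of code 2p - 1;
    this is the bound in the recursive call of [enum_op]. *)
Lemma op_followsE x y : 0 < y.1 -> op_follows x y = (letter_code y <= x.1.*2.-1).
Proof. by case: y => y [] /=; rewrite /op_follows /letter_code /=; lia. Qed.

(** A nonincreasing word in letters up to c either avoids the letter c or begins with it; these are
    the two branches of [enum_op]. The fuel suffices because c + w drops at each call. *)
Lemma mem_enum_op k c w s : c + w < k ->
  (s \in enum_op k c w) =
  [&& is_overpartition s, all (fun x => letter_code x <= c) s & op_weight s == w].
Proof.
elim: k c w s => // k IH c w s lt_cw; rewrite is_overpartitionE -andbA.
case: c lt_cw => [|c] lt_cw.
  have -> : (s \in enum_op k.+1 0 w) = (s == [::]) && (w == 0).
    by rewrite /=; case: w {lt_cw} => [|w]; rewrite ?inE ?andbT ?andbF.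
  case: s => [|[p b] s] /=; first by rewrite eq_sym.
  by apply/esym/negP => H; move: H; rewrite /letter_code /=; case: b; lia.
rewrite [enum_op _ _ _]/= mem_cat IH ?is_overpartitionE; last by lia.
case: s => [|x s] /=.
  rewrite /op_weight /=; case: eqP => //= _; case: ifP => // _.
  by apply/negP => /mapP[].
have -> : (x :: s \in if uphalf c.+1 <= w then map (cons (letter c.+1))
      (enum_op k (uphalf c.+1).*2.-1 (w - uphalf c.+1)) else [::])
  = [&& x == letter c.+1, x.1 <= w & s \in enum_op k x.1.*2.-1 (w - x.1)].
  apply/idP/and3P => [|[/eqP-> le_w s_in]].
    by case: ifP => // le_w /mapP[t t_in [-> ->]].
  by rewrite le_w; apply/mapP; exists s.
have -> : [&& x == letter c.+1, x.1 <= w & s \in enum_op k x.1.*2.-1 (w - x.1)]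
  = [&& x == letter c.+1, x.1 <= w, is_overpartition s,
        all (fun y => letter_code y <= x.1.*2.-1) s & op_weight s == w - x.1].
  case: eqP => //= ->; case: leqP => //= le_w; apply: IH.
  by move: le_w; rewrite /letter /=; lia.
rewrite (path_sortedE op_follows_trans) is_overpartitionE /op_weight /=.
have [x0 | x_gt0] := posnP x.1.
  by case: (x =P letter c.+1) x0 => [->|_] x0 //; rewrite !andbF.
case: (boolP (all (fun y => 0 < y.1) s)) => [/allP pos_s | _]; last first.
  by rewrite !(andbF, andFb).
have -> : all (op_follows x) s = all (fun y => letter_code y <= x.1.*2.-1) s.
  by apply: eq_in_all => y /pos_s; apply: op_followsE.
rewrite !andbT.
have code_x : x.1.*2.-1 <= letter_code x by rewrite /letter_code; case: x.2 => /=; lia.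
case: (boolP (all (fun y => letter_code y <= x.1.*2.-1) s)) => [/allP codes | _]; last first.
  by rewrite !(andbF, andFb).
have codes_le d : letter_code x <= d -> all (fun y => letter_code y <= d) s.
  by move=> le_xd; apply/allP => y /codes /leq_trans; apply; apply: leq_trans le_xd.
have -> : (x == letter c.+1) = (letter_code x == c.+1).
  rewrite -{1}(letter_codeK x_gt0); apply/eqP/eqP => [/(congr1 letter_code)|->] //.
  by rewrite !letterK.
have -> : (x.1 <= w) && (sorted op_follows s && (sumn (unzip1 s) == w - x.1))
  = sorted op_follows s && (x.1 + sumn (unzip1 s) == w) by case: sorted; lia.
have := codes_le c; have := codes_le c.+1.
case: (ltngtP (letter_code x) c.+1) => [lt_xc | gt_xc | ->] /=.
- by rewrite ltnS in lt_xc; rewrite lt_xc => /(_ isT)-> /(_ isT)->; rewrite orbF.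
- by rewrite leqNgt (ltn_trans (ltnSn c) gt_xc) !(andbF, andFb).
- by move=> /(_ isT)-> _; rewrite ltnn !(andbF, andFb).
Qed.

Lemma uniq_enum_op k c w : c + w < k -> uniq (enum_op k c w).
Proof.
elim: k c w => // k IH [|c] w lt_cw /=; first by case: eqP.
rewrite cat_uniq IH /=; last by lia.
case: leqP => //= le_w; rewrite map_inj_uniq ?IH; [|lia|by move=> s t []].
rewrite andbT; apply/hasPn => _ /mapP[s _ ->].
by rewrite /= mem_enum_op; [rewrite /= letterK ltnn !(andbF, andFb) | lia].
Qed.

Definition op_count c w := size (enum_op (c + w).+1 c w).

Lemma size_enum_op k c w : c + w < k -> size (enum_op k c w) = op_count c w.
Proof.
move=> lt_cw; apply/perm_size/uniq_perm; rewrite ?uniq_enum_op //.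
by move=> s; rewrite !mem_enum_op.
Qed.

Lemma op_count0 w : op_count 0 w = (w == 0).
Proof. by rewrite /op_count /=; case: eqP. Qed.

Lemma op_countS c w : op_count c.+1 w = op_count c w +
  (if uphalf c.+1 <= w then op_count (uphalf c.+1).*2.-1 (w - uphalf c.+1) else 0).
Proof.
have [k lt_k] : exists k, c.+1 + w < k by exists (c.+1 + w).+1.
rewrite -(@size_enum_op k.+1 c.+1 w) /=; last exact: ltnW.
rewrite size_cat size_enum_op; last by lia.
by case: leqP => // le_w; rewrite size_map size_enum_op //; lia.
Qed.

(** The bound [n.*2] is the code of the overlined n, the largest letter that a word of weight at
    most n can contain. *)
Lemma op_count_card n w : w <= n ->
  op_count n.*2 w =
  #|[set s : op_code n | is_overpartition (op_decode s) & op_weight (op_decode s) == w]|.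
Proof.
move=> le_wn; set A := [set _ | _ & _]; rewrite cardE -(size_map (@op_decode n)).
apply/perm_size/uniq_perm; first exact: uniq_enum_op.
  by rewrite map_inj_uniq ?enum_uniq //; apply: op_decode_inj.
move=> s; rewrite mem_enum_op //; apply/and3P/mapP => [[op_s _ /eqP w_s]|[x x_in ->]].
  have [|x sx] := overpartition_code (n := n) op_s; first by rewrite w_s.
  by exists x => //; rewrite mem_enum inE sx op_s w_s eqxx.
move: x_in; rewrite mem_enum inE => /andP[op_x ->]; split=> //.
rewrite /op_decode all_map; apply/allP => -[i b] _ /=.
by rewrite /letter_code /=; have := ltn_ord i; lia.
Qed.

(** * Product formula for the overpartition series *)

Local Open Scope ring_scope.

Definition op_gf (R : comNzRingType) n c : {poly R} := \poly_(w < n.+1) (op_count c w)%:R.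

Lemma op_gf_step (R : comNzRingType) n p c : uphalf c.+1 = p.+1 ->
  eqmodX n.+1 (op_gf R n c.+1) (op_gf R n c + op_gf R n p.*2.+1 * 'X^(p.+1)).
Proof.
move=> cp w lt_wn; rewrite coefD coefMXn !coef_poly lt_wn op_countS cp natrD.
congr (_ + _); rewrite [(w < p.+1)%N]ltnNge; case: leqP => //= le_w.
by rewrite (leq_ltn_trans (leq_subr _ _) lt_wn).
Qed.

Lemma op_gf_product (R : comNzRingType) n :
  eqmodX n.+1 (op_gf R n n.*2 * qminus 'X 0 n) (qplus 'X n).
Proof.
suff H m : eqmodX n.+1 (op_gf R n m.*2 * qminus 'X 0 m) (qplus 'X m) by apply: H.
elim: m => [|m IH].
  rewrite /qminus /qplus !big_geq // mulr1 => w lt_wn.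
  by rewrite coef_poly lt_wn op_count0 coef1.
set u : {poly R} := 'X^(m.+1).
have -> : qminus 'X 0 m.+1 = qminus 'X 0 m * (1 - u).
  by rewrite /qminus big_nat_recr.
have -> : qplus 'X m.+1 = qplus 'X m * (1 + u).
  by rewrite /qplus big_nat_recr.
have plain : eqmodX n.+1 (op_gf R n m.*2.+1 * (1 - u)) (op_gf R n m.*2).
  move=> w lt_wn; rewrite mulrBr mulr1 coefB (@op_gf_step _ n m) //; last by lia.
  by rewrite coefD addrK.
have over : eqmodX n.+1 (op_gf R n m.+1.*2) (op_gf R n m.*2.+1 * (1 + u)).
  move=> w lt_wn; rewrite mulrDr mulr1 doubleS (@op_gf_step _ n m) //; last by lia.
apply: eqmodX_trans (eqmodX_mul over (@eqmodX_refl _ _ _)) _.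
apply: eqmodX_trans (eqmodX_mul IH (@eqmodX_refl _ _ (1 + u))).
have plain' := eqmodX_mul plain (@eqmodX_refl _ _ (qminus 'X 0 m)).
apply: eqmodX_trans (eqmodX_mul plain' (@eqmodX_refl _ _ (1 + u))).
by move=> i _; apply: (congr1 (fun v : {poly R} => v`_i)); ring.
Qed.

(** After multiplication by [qplus], Gauss's formula turns [theta] into [qminus], and
    [op_gf_product] concludes. *)
Lemma op_gf_theta (R : comNzRingType) n :
  eqmodX n.+1 (op_gf R n n.*2 * theta 'X n) 1.
Proof.
have qplus0 : (qplus 'X n : {poly R})`_0 = 1.
  rewrite -horner_coef0 /qplus; elim: n => [|n IH]; first by rewrite big_geq // hornerC.
  by rewrite big_nat_recr //= hornerM IH !hornerE expr0n /= addr0.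
apply: (eqmodX_cancel qplus0); rewrite mul1r.
apply: eqmodX_trans (@op_gf_product R n); rewrite -mulrA.
exact: eqmodX_mul (@eqmodX_refl _ _ _) (@gauss_eqmodX R n).
Qed.

(** * Sums of four squares modulo 7 *)

Definition quad : Type := int * int * int * int.

Definition quad_norm (x : quad) : int :=
  let: (a, b, c, d) := x in a ^+ 2 + b ^+ 2 + c ^+ 2 + d ^+ 2.

(* Left multiplication of the quaternion [x] by [2 + e1 i + e2 j + e3 k]. *)
Definition quad_act (e : int * int * int) (x : quad) : quad :=
  let: (e1, e2, e3) := e in let: (a, b, c, d) := x in
  (2 * a - e1 * b - e2 * c - e3 * d, 2 * b + e1 * a + e2 * d - e3 * c,
   2 * c - e1 * d + e2 * a + e3 * b, 2 * d + e1 * c - e2 * b + e3 * a).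

Definition quad_conj (e : int * int * int) : int * int * int :=
  let: (e1, e2, e3) := e in (- e1, - e2, - e3).

Definition quad_dvd7 (x : quad) : bool :=
  let: (a, b, c, d) := x in [&& (7 %| a)%Z, (7 %| b)%Z, (7 %| c)%Z & (7 %| d)%Z].

(* The quaternions [2 + e1 i + e2 j + e3 k] represent the eight classes of
   Lipschitz quaternions of norm 7 modulo right multiplication by units. *)
Definition signs : seq (int * int * int) :=
  let pm := [:: 1; -1] in
  [seq (e, e3) | e <- [seq (e1, e2) | e1 <- pm, e2 <- pm], e3 <- pm].

Definition quad_scale (k : int) (x : quad) : quad :=
  let: (a, b, c, d) := x in (k * a, k * b, k * c, k * d).

Lemma signs_sqr e1 e2 e3 : (e1, e2, e3) \in signs ->
  [/\ e1 ^+ 2 = 1, e2 ^+ 2 = 1 & e3 ^+ 2 = 1].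
Proof.
have /allP H : all (fun e => [&& e.1.1 ^+ 2 == 1, e.1.2 ^+ 2 == 1 & e.2 ^+ 2 == 1]) signs.
  by [].
by move=> /H /and3P[/eqP-> /eqP-> /eqP->].
Qed.

(** Multiplicativity of the quaternion norm (Euler's four-square identity), with 7 = 4 + 1 + 1 +
    1. *)
Lemma quad_norm_act e x : e \in signs -> quad_norm (quad_act e x) = 7 * quad_norm x.
Proof.
move: e x => [[e1 e2] e3] [[[a b] c] d] /signs_sqr[E1 E2 E3].
rewrite /quad_norm /quad_act.
transitivity ((4 + e1 ^+ 2 + e2 ^+ 2 + e3 ^+ 2) * (a ^+ 2 + b ^+ 2 + c ^+ 2 + d ^+ 2)).
  by ring.
by rewrite E1 E2 E3; ring.
Qed.

Lemma quad_actK e x : e \in signs ->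
  quad_act (quad_conj e) (quad_act e x) = quad_scale 7 x.
Proof.
move: e x => [[e1 e2] e3] [[[a b] c] d] /signs_sqr[E1 E2 E3].
have <- : 4 + e1 ^+ 2 + e2 ^+ 2 + e3 ^+ 2 = 7 by rewrite E1 E2 E3.
rewrite /quad_scale /quad_act /quad_conj.
by congr (_, _, _, _); ring.
Qed.

Lemma quad_act_scale e k x : quad_act e (quad_scale k x) = quad_scale k (quad_act e x).
Proof.
move: e x => [[e1 e2] e3] [[[a b] c] d]; rewrite /quad_scale /quad_act.
by congr (_, _, _, _); ring.
Qed.

Lemma quad_scale_inj k : k != 0 -> injective (quad_scale k).
Proof.
move=> k0 [[[a b] c] d] [[[a' b'] c'] d'] [].
by move=> /(mulfI k0)-> /(mulfI k0)-> /(mulfI k0)-> /(mulfI k0)->.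
Qed.

Lemma quad_act_inj e : e \in signs -> injective (quad_act e).
Proof.
move=> e_sign x y /(congr1 (quad_act (quad_conj e))); rewrite !quad_actK //.
exact: quad_scale_inj.
Qed.

Lemma quad_dvd7P x : reflect (exists y, x = quad_scale 7 y) (quad_dvd7 x).
Proof.
move: x => [[[a b] c] d]; apply: (iffP and4P) => [[]|[[[[a' b'] c'] d'] [-> -> -> ->]]].
  move=> /dvdzP[a' ->] /dvdzP[b' ->] /dvdzP[c' ->] /dvdzP[d' ->].
  by exists (a', b', c', d'); rewrite /quad_scale; congr (_, _, _, _); ring.
by rewrite !dvdz_mulr.
Qed.

Definition quad_mod7 (x : quad) : quad :=
  let: (a, b, c, d) := x in (a %% 7, b %% 7, c %% 7, d %% 7)%Z.

Lemma quad_dvd7_mod e x : quad_dvd7 (quad_act e (quad_mod7 x)) = quad_dvd7 (quad_act e x).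
Proof.
move: e x => [[e1 e2] e3] [[[a b] c] d]; rewrite /quad_mod7 /quad_act /quad_dvd7.
have red u v w : v = u * 7 + w -> (7 %| w)%Z = (7 %| v)%Z.
  by move=> ->; lia.
have [qa qb qc qd] : [/\ a = (a %/ 7)%Z * 7 + (a %% 7)%Z, b = (b %/ 7)%Z * 7 + (b %% 7)%Z,
  c = (c %/ 7)%Z * 7 + (c %% 7)%Z & d = (d %/ 7)%Z * 7 + (d %% 7)%Z] by rewrite -!divz_eq.
move: (a %/ 7)%Z (a %% 7)%Z (b %/ 7)%Z (b %% 7)%Z (c %/ 7)%Z (c %% 7)%Z (d %/ 7)%Z (d %% 7)%Z
  qa qb qc qd => a1 a0 b1 b0 c1 c0 d1 d0 -> -> -> ->.
by congr [&& _, _, _ & _];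
  [apply: (red (2 * a1 - e1 * b1 - e2 * c1 - e3 * d1))
  |apply: (red (2 * b1 + e1 * a1 + e2 * d1 - e3 * c1))
  |apply: (red (2 * c1 - e1 * d1 + e2 * a1 + e3 * b1))
  |apply: (red (2 * d1 + e1 * c1 - e2 * b1 + e3 * a1))]; ring.
Qed.

Lemma quad_norm_mod7 x : (7 %| quad_norm (quad_mod7 x))%Z = (7 %| quad_norm x)%Z.
Proof.
move: x => [[[a b] c] d]; rewrite /quad_norm /quad_mod7.
have E m : m ^+ 2 =
    ((m %/ 7)%Z * (m %/ 7)%Z * 7 + 2 * (m %/ 7)%Z * (m %% 7)%Z) * 7 + (m %% 7)%Z ^+ 2.
  by rewrite {1}(divz_eq m 7); ring.
rewrite (E a) (E b) (E c) (E d); lia.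
Qed.

(* The count is 8 when 7 divides all of [a, b, c, d] and 1 otherwise. *)
Definition quad_residue_check : bool :=
  let r : seq int := [seq Posz i | i <- iota 0 7] in
  all (fun a => all (fun b => all (fun c => all (fun d =>
    (7 %| quad_norm (a, b, c, d))%Z ==>
    (count (fun e => quad_dvd7 (quad_act (quad_conj e) (a, b, c, d))) signs %% 7 == 1)%N)
  r) r) r) r.

Lemma quad_residue_checkT : quad_residue_check.
Proof. by vm_compute. Qed.

(** Hypothesis and count depend only on the coordinates modulo 7, which leaves the 7^4 residue
    vectors checked by computation. *)
Lemma count_quad_divisors x : (7 %| quad_norm x)%Z ->
  count (fun e => quad_dvd7 (quad_act (quad_conj e) x)) signs = 1 %[mod 7].
Proof.
rewrite -quad_norm_mod7 => N7.
under eq_count do rewrite -quad_dvd7_mod.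
have res m : (m %% 7)%Z \in [seq Posz i | i <- iota 0 7].
  apply/mapP; exists `|(m %% 7)%Z|%N; last by lia.
  by rewrite mem_iota; lia.
move: x N7 => [[[a b] c] d] N7.
move/allP/(_ _ (res a))/allP/(_ _ (res b)): quad_residue_checkT.
by move=> /allP/(_ _ (res c))/allP/(_ _ (res d)) /implyP/(_ N7)/eqP.
Qed.

(** * Representations by four squares as quaternions of given norm *)

Definition quad_decode n (f : {ffun 'I_4 -> 'I_n.*2.+1}) : quad :=
  (int_decode (f (inord 0)), int_decode (f (inord 1)),
   int_decode (f (inord 2)), int_decode (f (inord 3))).

Definition quad_reps n : seq quad :=
  [seq quad_decode f | f : {ffun 'I_4 -> 'I_n.*2.+1} in
     [set c : {ffun 'I_4 -> 'I_n.*2.+1} | (\sum_i int_decode (c i) ^+ 2 == n%:Z :> int)%R]].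

Lemma size_quad_reps n : size (quad_reps n) = sum_squares 4 n.
Proof. by rewrite size_map -cardE. Qed.

Lemma ord4_ind (P : 'I_4 -> Prop) :
  P (inord 0) -> P (inord 1) -> P (inord 2) -> P (inord 3) -> forall i, P i.
Proof.
move=> P0 P1 P2 P3 [[|[|[|[|//]]]] lt_i].
- by rewrite (_ : Ordinal _ = inord 0) //; apply/val_inj; rewrite /= inordK.
- by rewrite (_ : Ordinal _ = inord 1) //; apply/val_inj; rewrite /= inordK.
- by rewrite (_ : Ordinal _ = inord 2) //; apply/val_inj; rewrite /= inordK.
- by rewrite (_ : Ordinal _ = inord 3) //; apply/val_inj; rewrite /= inordK.
Qed.

Lemma sum_ord4 (F : 'I_4 -> int) :
  \sum_i F i = F (inord 0) + F (inord 1) + F (inord 2) + F (inord 3).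
Proof.
rewrite !big_ord_recr big_ord0 /= add0r.
by congr (_ + _ + _ + _); congr F; apply: val_inj; rewrite /= inordK.
Qed.

Lemma uniq_quad_reps n : uniq (quad_reps n).
Proof.
rewrite map_inj_uniq ?enum_uniq // => f g [] /int_decode_inj f0 /int_decode_inj f1.
by move=> /int_decode_inj f2 /int_decode_inj f3; apply/ffunP; apply: ord4_ind.
Qed.

Lemma mem_quad_reps n x : (x \in quad_reps n) = (quad_norm x == n%:Z).
Proof.
apply/imageP/eqP => [[f] | ].
  by rewrite inE sum_ord4 => /eqP <- ->.
move: x => [[[a b] c] d] norm_x.
pose x (i : 'I_4) := nth 0 [:: a; b; c; d] i.
have [|f fx] := @sum_squares_code 4 n x.
  by rewrite sum_ord4 /x !inordK.
exists f; first by rewrite inE sum_ord4 !fx /x !inordK //; apply/eqP.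
by rewrite /quad_decode !fx /x !inordK.
Qed.

(** Write e' for the conjugate of e, so e' e = e e' = 7. If y = e x then e' y = 7 x; conversely e' y
    = 7 x gives 7 y = 7 e x, and 7 cancels. *)
Lemma quad_act_reps n e : e \in signs ->
  perm_eq (map (quad_act e) (quad_reps n))
    (filter (fun x => quad_dvd7 (quad_act (quad_conj e) x)) (quad_reps (7 * n))).
Proof.
move=> e_sign; apply: uniq_perm.
- by rewrite (map_inj_uniq (quad_act_inj e_sign)) uniq_quad_reps.
- by rewrite filter_uniq ?uniq_quad_reps.
have e_sign' : quad_conj e \in signs.
  by have /allP := (isT : all (fun e => quad_conj e \in signs) signs); apply.
have conjK : quad_conj (quad_conj e) = e.
  by case: (e) => [[? ?] ?]; rewrite /quad_conj !opprK.
move=> y; rewrite mem_filter mem_quad_reps.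
apply/mapP/andP => [[x x_in ->] | [/quad_dvd7P[x xE]]].
  rewrite quad_actK // quad_norm_act //; split; first by apply/quad_dvd7P; exists x.
  by move: x_in; rewrite mem_quad_reps => /eqP ->.
have yE : y = quad_act e x.
  apply: (@quad_scale_inj 7) => //.
  by rewrite -quad_act_scale -xE -{1}conjK quad_actK.
rewrite yE quad_norm_act // => /eqP norm_x; exists x => //.
by rewrite mem_quad_reps; apply/eqP; lia.
Qed.

(* Count the pairs [(e, y)] with [quad_norm y = n] in two ways: [y] determines
   the left multiple [x = quad_act e y] of norm [7 n], and an [x] with norm
   divisible by 7 arises from 1 modulo 7 of the eight sign choices [e]. *)
Lemma sum_four_squares_mod7 n : sum_squares 4 (7 * n) = sum_squares 4 n %[mod 7].
Proof.
rewrite -!size_quad_reps.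
pose div e x := quad_dvd7 (quad_act (quad_conj e) x).
have E : (8 * size (quad_reps n) = \sum_(x <- quad_reps (7 * n)) count (div^~ x) signs)%N.
  transitivity (\sum_(e <- signs) count (div e) (quad_reps (7 * n)))%N.
    rewrite (eq_big_seq (fun=> size (quad_reps n))); last first.
      by move=> e e_sign; rewrite -size_filter -(perm_size (quad_act_reps n e_sign)) size_map.
    by rewrite big_const_seq count_predT iter_addn_0 mulnC.
  under eq_bigr do rewrite -sum1_count big_mkcond.
  rewrite exchange_big; apply: eq_bigr => x _ /=.
  by rewrite -big_mkcond sum1_count.
have M : (\sum_(x <- quad_reps (7 * n)) count (div^~ x) signs
    = size (quad_reps (7 * n)) %[mod 7])%N.
  rewrite -modn_summ (eq_big_seq (fun=> 1%N)) ?sum1_size //.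
  move=> x; rewrite mem_quad_reps => /eqP norm_x; rewrite count_quad_divisors // norm_x.
  by rewrite PoszM dvdz_mulr.
rewrite -M -E; lia.
Qed.

(** * Coefficient extraction *)

Lemma theta_low (R : comNzRingType) m n : (m <= n)%N ->
  eqmodX m.+1 (theta 'X n : {poly R}) (theta 'X m).
Proof.
move=> le_mn; rewrite /theta (big_cat_nat (n := m)) //= mulrDr addrA -[X in eqmodX _ _ X]addr0.
apply: eqmodX_add => // i lt_im; rewrite coef0 mulr_sumr coef_sum big_nat_cond big1 // => s.
rewrite andbT => /andP[le_ms _]; rewrite mulrA mulrC.
by rewrite (@eqmodX_mulXn _ m.+1) ?coef0 //; nia.
Qed.

(** Since s^2 and s have the same parity, each signed square power is a power of [- 'X]; the factor
    2 accounts for s and -s. *)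
Lemma theta_squares (R : comNzRingType) n :
  theta 'X n = \sum_(j < n.*2.+1) (- 'X) ^+ (`|int_decode j|%N ^ 2) :> {poly R}.
Proof.
pose F k : {poly R} := (- 'X) ^+ (k ^ 2).
have -> : theta 'X n = 1 + 2 * \sum_(0 <= s < n) F s.+1.
  congr (1 + 2 * _); apply: eq_bigr => s _.
  by rewrite /F [RHS]exprNn -[in LHS]signr_odd -[in RHS]signr_odd oddX.
suff H m : 1 + 2 * \sum_(0 <= s < m) F s.+1 = \sum_(0 <= j < m.*2.+1) F `|j%:Z - m%:Z|%N.
  by rewrite -(big_mkord xpredT (fun j => F `|j%:Z - n%:Z|%N)) -H.
elim: m => [|m IH].
  by rewrite big_geq // big_nat1 subrr /F mulr0 addr0 expr0.
rewrite big_nat_recr //= mulrDr addrA IH doubleS big_nat_recl // [in RHS]big_nat_recr //.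
have -> : `|(m.*2.+2)%:Z - m.+1%:Z|%N = m.+1 by lia.
have -> : `|0%:Z - m.+1%:Z|%N = m.+1 by lia.
rewrite [RHS]addrC -addrA [_ + F m.+1]addrC.
have -> : \sum_(0 <= i < m.*2.+1) F `|i.+1%:Z - m.+1%:Z|%N
  = \sum_(0 <= i < m.*2.+1) F `|i%:Z - m%:Z|%N.
  by apply: eq_bigr => i _; congr F; lia.
by ring.
Qed.

Lemma coef_theta_exp (R : comNzRingType) k m n : (m <= n)%N ->
  (theta 'X n ^+ k : {poly R})`_m = (-1) ^+ m * (sum_squares k m)%:R.
Proof.
(* Truncating at m makes the index set of the theta sum the one used by [sum_squares k m], so
   expanding the power runs over the same functions. *)
move=> le_mn; rewrite (eqmodX_exp k (@theta_low R m n le_mn)) // theta_squares.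
rewrite -[in LHS](card_ord k) -prodr_const bigA_distr_bigA coef_sum /=.
rewrite /sum_squares -sum1_card natr_sum mulr_sumr big_mkcond [RHS]big_mkcond /=.
apply: eq_bigr => f _; rewrite inE prodrXr.
have -> : (\sum_(i < k) int_decode (f i) ^+ 2 == m%:Z)
  = (m == \sum_(i < k) `|int_decode (f i)| ^ 2)%N.
  rewrite eq_sym -eqz_nat (big_morph Posz PoszD (erefl _)); congr (_ == _).
  by apply: eq_bigr => i _; rewrite -abszX gez0_abs ?sqr_ge0.
rewrite [in LHS]exprNn -[in LHS]signr_odd mulr_sign.
rewrite (fun_if (fun p : {poly R} => p`_m)) coefN coefXn.
by case: eqP => [<-|_]; [rewrite mulr1 -[in RHS]signr_odd; case: odd | rewrite oppr0 if_same].
Qed.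

(** Indexed by codes so that its k-th power expands over the functions counted by
    [overpartition_tuples]. Codes may weigh more than n, so only the coefficients up to n are
    meaningful. *)
Definition op_poly (R : comNzRingType) n : {poly R} :=
  \sum_(c : op_code n | is_overpartition (op_decode c)) 'X^(op_weight (op_decode c)).

Lemma op_poly_gf (R : comNzRingType) n : eqmodX n.+1 (op_poly R n) (op_gf R n n.*2).
Proof.
move=> w lt_wn; rewrite /op_poly coef_sum coef_poly lt_wn op_count_card //.
rewrite -sum1_card natr_sum big_mkcond [RHS]big_mkcond /=; apply: eq_bigr => c _.
by rewrite inE coefXn eq_sym; case: is_overpartition; case: eqP.
Qed.

Lemma coef_op_poly_exp (R : comNzRingType) k n :
  (op_poly R n ^+ k)`_n = (overpartition_tuples k n)%:R.
Proof.
rewrite /op_poly big_mkcond -[in LHS](card_ord k) -prodr_const bigA_distr_bigA coef_sum /=.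
rewrite /overpartition_tuples -sum1_card natr_sum [RHS]big_mkcond /=.
apply: eq_bigr => f _; rewrite inE.
case: forallP => [opf | nop] /=.
  rewrite (eq_bigr (fun i => 'X^(op_weight (op_decode (f i))))); last first.
    by move=> i _; rewrite opf.
  by rewrite prodrXr coefXn eq_sym; case: eqP.
have /forallPn[i /negPf nop_i] : ~~ [forall i, is_overpartition (op_decode (f i))].
  by apply/forallP.
by rewrite (bigD1 i) //= nop_i mul0r coef0.
Qed.

(** Frobenius in characteristic 7, applied to each power of [- 'X]; the sign persists because 7 is
    odd. *)
Lemma theta_exp7 n : theta 'X n ^+ 7 = theta 'X n \Po 'X^7 :> {poly 'F_7}.
Proof.
have char7 : 7%N \in [pchar {poly 'F_7}] by rewrite pchar_poly pchar_Fp.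
rewrite theta_squares -(pFrobenius_autE char7) !rmorph_sum /=.
apply: eq_bigr => j _; rewrite pFrobenius_autE -exprM mulnC exprM exprNn.
by rewrite -signr_odd mulN1r rmorphXn /= raddfN /= comp_polyX.
Qed.

Lemma overpartition_triples_F7 n :
  (overpartition_tuples 3 (7 * n))%:R = (-1) ^+ n * (sum_squares 3 n)%:R :> 'F_7.
Proof.
set N := (7 * n)%N; pose th : {poly 'F_7} := theta 'X N; pose P := op_poly 'F_7 N.
have le_nN : (n <= N)%N by rewrite leq_pmull.
have Pth : eqmodX N.+1 (P * th) 1.
  exact: eqmodX_trans (eqmodX_mul (@op_poly_gf _ N) (@eqmodX_refl _ _ _)) (@op_gf_theta _ N).
have th0 : th`_0 = 1 by rewrite /th (@theta_low _ 0) // /theta big_geq // mulr0 addr0 coef1.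
(* Here [th \Po 'X^7] is [th ^+ 7], and [P * th] is 1 to this order. *)
have main : eqmodX N.+1 (P ^+ 3 * (th \Po 'X^7)) (th ^+ 4).
  rewrite -theta_exp7 -/th (_ : P ^+ 3 * th ^+ 7 = (P * th) ^+ 3 * th ^+ 4); last by ring.
  have := eqmodX_mul (eqmodX_exp 3 Pth) (@eqmodX_refl _ N.+1 (th ^+ 4)).
  by rewrite expr1n mul1r.
have cut : eqmodX n.+1 (multisect 7 (P ^+ 3)) (th ^+ 3).
  (* Multiplied by [th], the left side becomes the extraction of [P ^+ 3 * (th \Po 'X^7)], that is
     of [th ^+ 4]; it remains to compare the coefficients of [th ^+ 4] at 7 m and m. *)
  apply: (eqmodX_cancel th0); rewrite -multisect_mul // -exprSr => m lt_mn.
  rewrite coef_multisect // main; last by rewrite /N; lia.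
  rewrite !coef_theta_exp; [|lia|rewrite /N; lia].
  (* The signs agree because 7 m and m have the same parity. *)
  rewrite -signr_odd oddM signr_odd; congr (_ * _).
  by rewrite -(@Fp_nat_mod 7) // sum_four_squares_mod7 Fp_nat_mod.
by rewrite -coef_op_poly_exp -/P -coef_multisect // cut // coef_theta_exp //.
Qed.

Theorem theorem4p1 (n : nat) (n_ge1 : (1 <= n)%N) :
  ((overpartition_tuples 3 (7 * n)%N)%:Z
     = (-1) ^+ n * (sum_squares 3 n)%:Z %[mod 7])%Z.
Proof.
apply/eqP; rewrite eqz_mod_dvd (dvdz_pcharf (pchar_Fp (isT : prime 7))).
rewrite rmorphB rmorphM rmorphXn /= rmorphN rmorph1 -!pmulrn.
by rewrite overpartition_triples_F7 subrr.
Qed.
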